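(* Let $\mathfrak g$ be a symmetrizable Kac--Moody superalgebra (as in the context) and let $M$ be a highest weight $\mathfrak g$-supermodule. Then the relative Dirac operator on $M\otimes M(\mathfrak g_{\bar1})$ satisfies $\ker\mathrm D^2_{\mathfrak g,\mathfrak g_{\bar0}}\neq\{0\}$.
   Context: Kac--Moody superalgebras: for $I=\{1,\dots,n\}$, an $n\times n$ matrix $A=(a_{ij})$ with $a_{ii}\in\{0,2\}$, a parity function $p:I\to\mathbb Z_2$, and $\mathfrak h$ even of dimension $2n-\operatorname{rk}A$ with linearly independent $\alpha_i\in\mathfrak h^*$, $h_i\in\mathfrak h$, $\alpha_j(h_i)=a_{ij}$, let $\mathfrak g(A)$ be the Lie superalgebra generated by $\mathfrak h$ and $X_i,Y_i$ (parity $p(i)$) with $[h,X_i]=\alpha_i(h)X_i$, $[h,Y_i]=-\alpha_i(h)Y_i$, $[X_i,Y_j]=\delta_{ij}h_i$, $[\mathfrak h,\mathfrak h]=0$, modulo the maximal ideal meeting $\mathfrak h$ trivially. It is a Kac--Moody superalgebra if it is quasisimple (every ideal is contained in $\mathfrak h$ or together with $\mathfrak h$ spans), regular ($a_{ij}=0\Rightarrow a_{ji}=0$) and admissible ($a_{ii}=0,p(i)=\bar0\Rightarrow a_{ij}=0\ \forall j$; $a_{ii}=2,p(i)=\bar0\Rightarrow a_{ij}\in\mathbb Z_{\le0}$ for $j\ne i$; $a_{ii}=2,p(i)=\bar1\Rightarrow a_{ij}\in2\mathbb Z_{\le0}$ for $j\neq i$); symmetrizable if $DA$ is symmetric for an invertible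 diagonal $D=\operatorname{diag}(d_i)$, in which case it has the nondegenerate even supersymmetric invariant standard form $B$ with $B(h,h_j)=d_j\alpha_j(h)$. Standing assumption: $B(\alpha,\beta)\in\mathbb R$ for all simple roots. Principal grading: $\deg X_i=1$, $\deg Y_i=-1$, $\deg\mathfrak h=0$. Triangular decomposition $\mathfrak g=\mathfrak n^-\oplus\mathfrak h\oplus\mathfrak n^+$. Standing assumption for the relative Dirac operator: the Kac--Peterson class of $\mathfrak g_{\bar0}$ is trivial, i.e. there is $\rho_{\bar0}\in\mathfrak h^*$ (extended by zero to root spaces) with $\rho_{\bar0}([x,y])=\tfrac12\operatorname{tr}(\mathrm{ad}_x\pi_-\mathrm{ad}_y\pi_+)-\tfrac12\operatorname{tr}(\mathrm{ad}_y\pi_-\mathrm{ad}_x\pi_+)$ on $\mathfrak g_{\bar0}$, $\pi_\pm$ the projections of $\mathfrak g_{\bar0}$ onto its parts of positive, resp. nonpositive, principal degree. Highest weight supermodule: an $\mathfrak h$-weight supermodule with finite-dimensional weight spaces generated by a nonzero weight vector $v_\Lambda$ with $\mathfrak n^+v_\Lambda=0$. Oscillator module: put $(\mathfrak g_{\bar1})_\pm=\mathfrak g_{\bar1}\cap\mathfrak n^\pm$ with bases of root vectors $(x_a)$ of $(\mathfrak g_{\bar1})_-$ and $(\partial_a)$ of $(\mathfrak g_{\bar1})_+$, $B(\partial_a,x_b)=\tfrac12\delta_{ab}$. $\mathrm{Cl}(\mathfrak g_{\bar1})$ (relations $xy-yx=2B(x,y)$) acts on $M(\mathfrak g_{\bar1})=S((\mathfrak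 g_{\bar1})_-)=\mathbb C[x_1,x_2,\dots]$, $x_a$ by multiplication, $\partial_a$ by $\partial/\partial x_a$. The relative Dirac operator on $M\otimes M(\mathfrak g_{\bar1})$ is $\mathrm D_{\mathfrak g,\mathfrak g_{\bar0}}=2\sum_a(x_a\otimes\partial_a-\partial_a\otimes x_a)$ with $(y\otimes z)(v\otimes P)=(-1)^{p(v)}yv\otimes zP$ for $y,z\in\mathfrak g_{\bar1}$ (finitely many nonzero terms on each vector).
   Formalization: The standard form is normalized by B(h,h_j) = d_j^{-1} α_j(h) instead of d_j α_j(h): with DA symmetric, the latter contradicts the symmetry of B unless d_i^2 = d_j^2 whenever a_ij ≠ 0 (it fails for type B_2). *)

(* Defs.v *)
From HB Require Import structures.
From mathcomp Require Import all_boot all_order all_algebra.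
From mathcomp Require Import sesquilinear.
From mathcomp Require Import boolp classical_sets functions cardinality fsbigop reals.
From mathcomp Require Import finmap complex monalg.

Set Implicit Arguments.
Unset Strict Implicit.
Unset Printing Implicit Defensive.

Import GRing.Theory Num.Theory.
Local Open Scope classical_set_scope.
Local Open Scope ring_scope.

(* Parities are booleans, [true] being odd; signs are [(-1) ^+ (b && c)].     *)

Section LinearAlgebra.
Context {C : numFieldType}.
Implicit Types (U V W : lmodType C).

Definition subspace V (U : set V) : Prop :=
  U 0 /\ forall (a : C) x y, U x -> U y -> U (a *: x + y).

Definition lspan V (S : set V) : set V :=
  [set x | forall U : set V, subspace U -> S `<=` U -> U x].

Definition finite_dim V (U : set V) : Prop :=
  exists (m : nat) (b : 'I_m -> V), forall v, U v ->
    exists c : 'I_m -> C, v = \sum_i c i *: b i.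

(* [b] is a Hamel basis of the subspace [U]. *)
Definition basis_of_set (J : choiceType) V (U : set V) (b : J -> V) : Prop :=
  [/\ forall j, U (b j),
      forall (s : seq J) (c : J -> C), uniq s ->
        \sum_(j <- s) c j *: b j = 0 -> {in s, forall j, c j = 0}
    & forall v, U v -> exists (s : seq J) (c : J -> C),
        v = \sum_(j <- s) c j *: b j].

(* [f], restricted to [U], is an operator of finite rank on [U] with trace    *)
(* [c]: written as [\sum_i phi_i(-) u_i], its trace is [\sum_i phi_i(u_i)].   *)
Definition has_trace_on V (U : set V) (f : V -> V) (c : C) : Prop :=
  exists (m : nat) (u : 'I_m -> V) (phi : 'I_m -> {scalar V}),
    [/\ forall i, U (u i),
        forall v, U v -> f v = \sum_i phi i v *: u i
      & c = \sum_i phi i (u i)].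

(* Tensor product of vector spaces, by its universal property. *)
Record tensor_product (U V : lmodType C) := TensorProduct {
  tprod :> lmodType C;
  tens : {bilinear U -> V -> tprod};
  tens_lift : forall (W : lmodType C) (f : {bilinear U -> V -> W}),
    exists g : {linear tprod -> W}, forall u v, g (tens u v) = f u v;
  tens_ext : forall (W : lmodType C) (g1 g2 : {linear tprod -> W}),
    (forall u v, g1 (tens u v) = g2 (tens u v)) -> g1 =1 g2 }.

End LinearAlgebra.

Section Super.
Context {C : numFieldType}.

(* A Z/2-graded vector space, the grading being recorded by the projections   *)
(* [hcomp b] onto the components of parity [b].                               *)
Record superspace := Superspace {
  ssort :> lmodType C;
  hcomp : bool -> {linear ssort -> ssort};
  hcompK : forall b c v, hcomp b (hcomp c v) = if b == c then hcomp b v else 0;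
  hcompD : forall v, hcomp false v + hcomp true v = v }.
Arguments hcomp {V} : rename.

Definition homog (V : superspace) (b : bool) : set V := [set v | hcomp b v = v].

Definition super_subspace (V : superspace) (U : set V) : Prop :=
  subspace U /\ forall b v, U v -> U (hcomp b v).

Record lieSuper := LieSuper {
  lsort :> superspace;
  br : {bilinear lsort -> lsort -> lsort};
  br_homog : forall b c x y, homog b x -> homog c y -> homog (b (+) c) (br x y);
  br_skew : forall b c x y, homog b x -> homog c y ->
    br x y = - ((-1) ^+ (b && c) *: br y x);
  br_jacobi : forall b c x y z, homog b x -> homog c y ->
    br x (br y z) = br (br x y) z + (-1) ^+ (b && c) *: br y (br x z) }.

Arguments br {L} : rename.

Definition lie_hom (L L' : lieSuper) (f : {linear L -> L'}) : Prop :=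
  (forall b x, f (hcomp b x) = hcomp b (f x)) /\
  (forall x y, f (br x y) = br (f x) (f y)).

Definition ideal (L : lieSuper) (I : set L) : Prop :=
  super_subspace I /\ forall x y, I y -> I (br x y).

Definition subalgebra (L : lieSuper) (S : set L) : Prop :=
  super_subspace S /\ forall x y, S x -> S y -> S (br x y).

Definition gen_subalgebra (L : lieSuper) (S : set L) : set L :=
  [set x | forall U, subalgebra U -> S `<=` U -> U x].

Record supermodule (L : lieSuper) := Supermodule {
  msort :> superspace;
  act : {bilinear L -> msort -> msort};
  act_homog : forall b c x v, homog b x -> homog c v ->
    homog (b (+) c) (act x v);
  act_br : forall b c x y v, homog b x -> homog c y ->
    act (br x y) v = act x (act y v) - (-1) ^+ (b && c) *: act y (act x v) }.

Arguments act {L M} : rename.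

Definition submodule (L : lieSuper) (M : supermodule L) (N : set M) : Prop :=
  subspace N /\ forall x v, N v -> N (act x v).

End Super.
Arguments superspace C : clear implicits.
Arguments hcomp {C V} : rename.
Arguments homog {C V} b.
Arguments br {C L} : rename.
Arguments act {C L M} : rename.
Arguments lieSuper C : clear implicits.

Section KacMoody.
Context {C : numFieldType}.

(* The matrix [cmat] with the parity function and the realization             *)
(* [(cartan, sroot, scoroot)].                                                *)
Record cartan_datum := CartanDatum {
  crank : nat;
  cmat : 'M[C]_crank;
  cpar : 'I_crank -> bool;
  cartan : vectType C;
  sroot : crank.-tuple 'Hom(cartan, C^o);
  scoroot : crank.-tuple cartan;
  cmat_diag : forall i, cmat i i = 0 \/ cmat i i = 2;
  cartan_dim : \dim {: cartan} = (2 * crank - \rank cmat)%N;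
  sroot_free : free sroot;
  scoroot_free : free scoroot;
  sroot_coroot : forall i j, tnth sroot j (tnth scoroot i) = cmat i j }.

Definition weight (cd : cartan_datum) := 'Hom(cartan cd, C^o).

Record generators (cd : cartan_datum) (L : lieSuper C) := Generators {
  genH : {linear cartan cd -> L};
  genX : 'I_(crank cd) -> L;
  genY : 'I_(crank cd) -> L }.

Definition relations cd (L : lieSuper C) (G : generators cd L) : Prop :=
  (forall h, homog false (genH G h)) /\
  (forall i, homog (cpar i) (genX G i)) /\
  (forall i, homog (cpar i) (genY G i)) /\
  (forall h i, br (genH G h) (genX G i) = tnth (sroot cd) i h *: genX G i) /\
  (forall h i, br (genH G h) (genY G i) = - (tnth (sroot cd) i h *: genY G i)) /\
  (forall i j, br (genX G i) (genY G j) =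
     if i == j then genH G (tnth (scoroot cd) i) else 0) /\
  (forall h h', br (genH G h) (genH G h') = 0).

Definition hom_generators cd (L L' : lieSuper C) (f : {linear L -> L'})
    (G : generators cd L) (G' : generators cd L') : Prop :=
  [/\ lie_hom f, forall h, f (genH G h) = genH G' h,
      forall i, f (genX G i) = genX G' i & forall i, f (genY G i) = genY G' i].

(* [L] is the Lie superalgebra with generators [G] and defining relations     *)
(* [relations].                                                               *)
Definition presented cd (L : lieSuper C) (G : generators cd L) : Prop :=
  [/\ relations G,
      gen_subalgebra (range (genH G) `|` range (genX G) `|` range (genY G)) = setT
    & forall (L' : lieSuper C) (G' : generators cd L'), relations G' ->
        exists f : {linear L -> L'}, hom_generators f G G'].

Definition meets_trivially cd (L : lieSuper C) (G : generators cd L)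
    (I : set L) : Prop := I `&` range (genH G) `<=` [set 0].

Definition maximal_trivial_ideal cd (L : lieSuper C) (G : generators cd L)
    (K : set L) : Prop :=
  [/\ ideal K, meets_trivially G K
    & forall I, ideal I -> meets_trivially G I -> I `<=` K].

(* The Lie superalgebra g(A): a quotient, by its maximal ideal meeting the    *)
(* Cartan subalgebra trivially, of the superalgebra presented as above.       *)
Record contragredient (cd : cartan_datum) := Contragredient {
  gA :> lieSuper C;
  gen : generators cd gA;
  gA_quotient : exists (Lt : lieSuper C) (Gt : generators cd Lt)
      (pi : {linear Lt -> gA}),
    [/\ presented Gt, hom_generators pi Gt gen, range pi = setT
      & maximal_trivial_ideal Gt [set x | pi x = 0]] }.

Section Algebra.
Variables (cd : cartan_datum) (g : contragredient cd).
Local Notation A := (cmat cd).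
Local Notation p := (@cpar cd).
Local Notation h := (genH (gen g)).
Local Notation X := (genX (gen g)).
Local Notation Y := (genY (gen g)).

Definition quasisimple : Prop := forall I : set g, ideal I ->
  I `<=` range h \/ (forall x, exists2 y, I y & exists t, x = y + h t).

Definition regular : Prop := forall i j, A i j = 0 -> A j i = 0.

Definition admissible : Prop := forall i,
  [/\ A i i = 0 -> p i = false -> forall j, A i j = 0,
      A i i = 2 -> p i = false -> forall j, j != i ->
        exists k : nat, A i j = - k%:R
    & A i i = 2 -> p i = true -> forall j, j != i ->
        exists k : nat, A i j = - (2 * k)%:R].

Definition kac_moody : Prop := [/\ quasisimple, regular & admissible].

Definition symmetrizes (d : 'rV[C]_(crank cd)) : Prop :=
  diag_mx d \in unitmx /\ (diag_mx d *m A)^T = diag_mx d *m A.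

(* If [diag_mx d *m A] is symmetric then the normalization of the form that   *)
(* makes it symmetric on the coroots is [B(h, h_j) = d_j^-1 alpha_j(h)].      *)
Definition standard_form (d : 'rV[C]_(crank cd)) (B : {biscalar g}) : Prop :=
  (forall x, (forall y, B x y = 0) -> x = 0) /\
  (forall x y, homog false x -> homog true y -> B x y = 0) /\
  (forall b c x y, homog b x -> homog c y ->
     B x y = (-1) ^+ (b && c) * B y x) /\
  (forall x y z, B (br x y) z = B x (br y z)) /\
  (forall t j, B (h t) (h (tnth (scoroot cd) j)) =
     (d 0 j)^-1 * (tnth (sroot cd) j t : C)).

(* [u] corresponds to [phi] under the isomorphism of the Cartan subalgebra    *)
(* with its dual given by [B]; the form on the dual is transported along it.  *)
Definition dual_elt (B : {biscalar g}) (phi : weight cd) (u : cartan cd) : Prop :=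
  forall t, B (h t) (h u) = phi t.

Definition simple_roots_real (B : {biscalar g}) : Prop :=
  forall i j u v, dual_elt B (tnth (sroot cd) i) u ->
    dual_elt B (tnth (sroot cd) j) v -> B (h u) (h v) \is Num.real.

Definition root_space (beta : weight cd) : set g :=
  [set x | forall t, br (h t) x = (beta t : C) *: x].

Definition root_vector (x : g) : Prop :=
  x <> 0 /\ exists2 beta : weight cd, beta <> 0 & root_space beta x.

Definition nplus : set g := gen_subalgebra (range X).
Definition nminus : set g := gen_subalgebra (range Y).

Inductive principal : int -> g -> Prop :=
| principalX i : principal 1 (X i)
| principalY i : principal (-1) (Y i)
| principalH t : principal 0 (h t)
| principal0 k : principal k 0
| principalL k (a : C) x y :
    principal k x -> principal k y -> principal k (a *: x + y)
| principalB k l x y :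
    principal k x -> principal l y -> principal (k + l) (br x y).

Definition even_positive : set g :=
  homog false `&` lspan [set x | exists2 k : int, (0 < k)%R & principal k x].
Definition even_nonpositive : set g :=
  homog false `&` lspan [set x | exists2 k : int, (k <= 0)%R & principal k x].

(* [rho] is [rho0] extended by zero to the root spaces. The values of [pp],   *)
(* [pm] and [rho] on the odd part are irrelevant.                             *)
Definition kac_peterson_trivial : Prop :=
  exists (pp pm : {linear g -> g}) (rho0 : weight cd) (rho : {scalar g}),
  (forall x, homog false x ->
     [/\ even_positive (pp x), even_nonpositive (pm x) & pp x + pm x = x]) /\
  (forall t, rho (h t) = rho0 t) /\
  (forall beta x, beta <> 0 -> root_space beta x -> rho x = 0) /\
  (forall x y, homog false x -> homog false y -> exists s t : C,
     [/\ has_trace_on (homog false) (fun z => br x (pm (br y (pp z)))) s,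
         has_trace_on (homog false) (fun z => br y (pm (br x (pp z)))) t
       & rho (br x y) = s / 2 - t / 2]).

Section Module.
Variable M : supermodule g.

Definition weight_space (lambda : weight cd) : set M :=
  [set v | forall t, act (h t) v = (lambda t : C) *: v].

Definition weight_module : Prop := forall v : M,
  exists (m : nat) (lambda : 'I_m -> weight cd) (u : 'I_m -> M),
    (forall i, weight_space (lambda i) (u i)) /\ v = \sum_i u i.

Definition highest_weight : Prop :=
  [/\ weight_module, forall lambda, finite_dim (weight_space lambda)
    & exists (Lambda : weight cd) (v : M),
      [/\ v <> 0, weight_space Lambda v, forall x, nplus x -> act x v = 0
        & forall N : set M, submodule N -> N v -> N = setT]].

End Module.

Section Oscillator.
Variables (B : {biscalar g}) (J : choiceType).
Implicit Types x dx : J -> g.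

Definition dual_odd_bases x dx : Prop :=
  [/\ basis_of_set (homog true `&` nminus) x,
      basis_of_set (homog true `&` nplus) dx,
      forall a, root_vector (x a) /\ root_vector (dx a)
    & forall a b, B (dx a) (x b) = if a == b then 2^-1 else 0].

End Oscillator.
End Algebra.

(* M(g_1) = C[x_a : a in J] *)
Definition oscillator_space (J : choiceType) := {malg C[{cmonom J}]}.

Definition osc_var (J : choiceType) (a : J) : oscillator_space J := << ucm a >>.

Definition osc_deriv (J : choiceType) (a : J) (P : oscillator_space J) :
    oscillator_space J :=
  \sum_(m <- msupp P) << P@_m *+ m a *g divcm m (ucm a) >>.

(* [osc] gives the operators on M(g_1) by which the odd elements of g, which  *)
(* generate Cl(g_1), act.                                                     *)
Definition oscillator_action cd (g : contragredient cd) (B : {biscalar g})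
    (J : choiceType) (x dx : J -> g)
    (osc : g -> {linear oscillator_space J -> oscillator_space J}) : Prop :=
  (forall (a : C) y z P, homog true y -> homog true z ->
     osc (a *: y + z) P = a *: osc y P + osc z P) /\
  (forall y z P, homog true y -> homog true z ->
     osc y (osc z P) - osc z (osc y P) = (2 * B y z) *: P) /\
  (forall a P, osc (x a) P = osc_var a * P) /\
  (forall a P, osc (dx a) P = osc_deriv a P).

(* [op y z] is the operator [y \otimes z] on M \otimes M(g_1).                *)
Definition tensor_action cd (g : contragredient cd) (M : supermodule g)
    (J : choiceType)
    (osc : g -> {linear oscillator_space J -> oscillator_space J})
    (T : tensor_product M (oscillator_space J))
    (op : g -> g -> {linear T -> T}) : Prop :=
  forall y z b (v : M) (P : oscillator_space J),
    homog true y -> homog true z -> homog b v ->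
    op y z (tens T v P) = (-1) ^+ b *: tens T (act y v) (osc z P).

(* The sum is over the finitely many [a] whose term is nonzero. *)
Definition relative_dirac cd (g : contragredient cd) (J : choiceType)
    (x dx : J -> g) (T : lmodType C) (op : g -> g -> {linear T -> T}) (t : T) : T :=
  2 *: \sum_(a \in [set: J]) (op (x a) (dx a) t - op (dx a) (x a) t).

End KacMoody.
Arguments cartan_datum C : clear implicits.
Arguments oscillator_space C J : clear implicits.

(* Main.v *)
Require Import Defs.
From HB Require Import structures.
From mathcomp Require Import all_boot all_order all_algebra.
From mathcomp Require Import sesquilinear reals complex finmap monalg.
From mathcomp Require Import boolp fsbigop.

(** If $v_\Lambda$ is a highest weight vector, then $v_\Lambda\otimes 1$ is
    annihilated by D itself: in each summand either $\partial_a$ kills the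
    constant polynomial 1, or the positive root vector $\partial_a$ kills
    $v_\Lambda$. Since the odd positive root vectors also kill the homogeneous
    components of $v_\Lambda$, it may be taken homogeneous. *)

Set Implicit Arguments.
Unset Strict Implicit.
Unset Printing Implicit Defensive.

Import GRing.Theory.
Local Open Scope ring_scope.

Lemma osc_deriv1 (C : numFieldType) (J : choiceType) (a : J) :
  osc_deriv a (1 : oscillator_space C J) = 0.
Proof.
rewrite /osc_deriv (_ : 1 = << (mone : {cmonom J}) >>) //.
by rewrite msuppU1 big_seq_fset1 cm1 mulr0n monalgU0.
Qed.

Section TensorOne.
Context {C : numFieldType} (U : lmodType C) (J : choiceType).

(** The value of [P] at the origin times [u], a bilinear map to feed to the universal property of
    the tensor product. *)
Definition scale_const_coeff (u : U) (P : oscillator_space C J) : U :=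
  P@_(mone : cmonom J) *: u.

Fact scale_const_coeff_bilinear :
  bilinear_for *:%R *:%R scale_const_coeff.
Proof.
split=> [P a u v | u a P Q]; rewrite /scale_const_coeff /=.
  by rewrite scalerDr !scalerA mulrC.
by rewrite mcoeffD mcoeffZ scalerDl scalerA.
Qed.

HB.instance Definition _ := bilinear_isBilinear.Build C U (oscillator_space C J)
  U *:%R *:%R scale_const_coeff scale_const_coeff_bilinear.

(** The linear map induced by [scale_const_coeff] is a left inverse of $u\mapsto u\otimes 1$, as the
    constant coefficient of 1 is 1. *)
Lemma tens_one_eq0 (T : tensor_product U (oscillator_space C J)) (u : U) :
  tens T u 1 = 0 -> u = 0.
Proof.
have [f fE] := tens_lift T (scale_const_coeff : {bilinear _ -> _ -> _}).
by move=> /(congr1 f); rewrite fE linear0 /= /scale_const_coeff mcoeff1 eqxx scale1r.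
Qed.

End TensorOne.

Section HomogeneousComponents.
Context {C : numFieldType}.

Lemma homog_hcomp (V : superspace C) b (v : V) : homog b (hcomp b v).
Proof. by rewrite /homog /= hcompK eqxx. Qed.

Lemma hcomp_neq0 (V : superspace C) (v : V) : v <> 0 ->
  exists b, hcomp b v <> 0.
Proof.
move=> v0; apply: contrapT => h; apply: v0.
have hc b : hcomp b v = 0 by apply: contrapT => hb; apply: h; exists b.
by rewrite -(hcompD v) !hc addr0.
Qed.

(** By [act_homog], [y] sends the two components of [v] to opposite parities, and only the image of
    [hcomp c v] has parity [b (+) c]. *)
Lemma hcomp_act (L : lieSuper C) (M : supermodule L) b c (y : L) (v : M) :
  homog b y -> hcomp (b (+) c) (act y v) = act y (hcomp c v).
Proof.
move=> hy; have hb e : homog (b (+) e) (act y (hcomp e v)).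
  exact: act_homog hy (homog_hcomp _ _).
rewrite -{1}(hcompD v) linearDr linearD /=.
(* Each image is written as its own projection, so that [hcompK] decides which one survives. *)
rewrite -(hb false) -(hb true) !hcompK -(hb c).
by case: b c {hb hy} => [] []; rewrite /= ?hcompK /= ?addr0 ?add0r.
Qed.

End HomogeneousComponents.

Lemma relative_dirac_eq0 (C : numFieldType) (cd : cartan_datum C)
    (g : contragredient cd) (J : choiceType) (x dx : J -> g) (T : lmodType C)
    (op : g -> g -> {linear T -> T}) (t : T) :
  (forall a, op (x a) (dx a) t = 0) -> (forall a, op (dx a) (x a) t = 0) ->
  relative_dirac x dx op t = 0.
Proof.
by move=> h1 h2; rewrite /relative_dirac fsbig1 ?scaler0// => a _; rewrite h1 h2 subr0.
Qed.

Theorem proposition87 (R : realType)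
    (cd : cartan_datum R[i]) (g : contragredient cd) (Hg : kac_moody g)
    (d : 'rV[R[i]]_(crank cd)) (Hd : symmetrizes d)
    (B : {biscalar g}) (HB : standard_form d B) (Hreal : simple_roots_real B)
    (HKP : kac_peterson_trivial g)
    (M : supermodule g) (HM : highest_weight M)
    (J : choiceType) (x dx : J -> g) (Hx : dual_odd_bases B x dx)
    (osc : g -> {linear oscillator_space R[i] J -> oscillator_space R[i] J})
    (Hosc : oscillator_action B x dx osc)
    (T : tensor_product M (oscillator_space R[i] J))
    (op : g -> g -> {linear T -> T}) (Hop : tensor_action osc op) :
  exists t : T, t <> 0 /\
    relative_dirac x dx op (relative_dirac x dx op t) = 0.
Proof.
have [[x_odd _ _] [dx_odd _ _] _ _] := Hx.
have [_ [_ [_ osc_dx]]] := Hosc.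
have [_ _ [Lambda [v [v0 _ nplus_v _]]]] := HM.
have [b vb0] := hcomp_neq0 v0.
exists (tens T (hcomp b v) 1); split; first by move=> /tens_one_eq0.
rewrite (_ : relative_dirac x dx op (tens _ _ _) = 0); last first.
  apply: relative_dirac_eq0 => a;
    have [[xa _] [dxa dxa_pos]] := (x_odd a, dx_odd a);
    (* [tensor_action] prescribes [op] only on homogeneous vectors, hence the choice of a component
       of [v]. *)
    rewrite (Hop _ _ b) //; try exact: homog_hcomp.
    by rewrite osc_dx osc_deriv1 linear0r scaler0.
  (* The projection is moved outside the action, where [dx a] in [nplus] meets [v] itself. *)
  by rewrite -(hcomp_act _ _ dxa) nplus_v // !linear0 linear0l scaler0.
(* The outer operator is now applied to 0. *)
by apply: relative_dirac_eq0 => a; rewrite linear0.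
Qed.
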